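(* For a system $(\mathrm D)$ of degree $n$ the following statements are equivalent: (1) the infinitely removed straight line of the projective phase plane $\mathbb{RP}(x,y)$ consists of trajectories of $(\mathrm D)$; (2) the polynomial $W_n$ is not identically zero on $\mathbb{R}^2$; (3) the system $(\mathrm D)$ is projectively nonsingular; (4) the first projectively reduced system of $(\mathrm D)$ is $$\frac{d\xi}{d\tau}=\sum_{i=0}^n\theta^{n-i}W_i(1,\xi),\qquad \frac{d\theta}{d\tau}=-\theta\sum_{i=0}^n\theta^{n-i}X_i(1,\xi);$$ (5) the straight line $\theta=0$ consists of trajectories of the first projectively reduced system of $(\mathrm D)$; (6) the second projectively reduced system of $(\mathrm D)$ is $$\frac{d\eta}{d\nu}=-\eta\sum_{i=0}^n\eta^{n-i}Y_i(\zeta,1),\qquad \frac{d\zeta}{d\nu}=-\sum_{i=0}^n\eta^{n-i}W_i(\zeta,1);$$ (7) the straight line $\eta=0$ consists of trajectories of the second projectively reduced system of $(\mathrm D)$.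
   Context: System $(\mathrm D)$ of degree $n$: $\frac{dx}{dt}=X(x,y)=\sum_{k=0}^n X_k(x,y)$, $\frac{dy}{dt}=Y(x,y)=\sum_{k=0}^n Y_k(x,y)$, where $X_k,Y_k$ are real homogeneous polynomials of degree $k$, $X_n$ and $Y_n$ are not both identically zero, and $X,Y$ are relatively prime (no common divisors other than real numbers). Put $W_i(x,y)=xY_i(x,y)-yX_i(x,y)$, $i=0,\dots,n$. The system is projectively nonsingular if $W_n\not\equiv 0$ on $\mathbb{R}^2$, and projectively singular if $W_n\equiv0$. Reduced systems. The substitution $x=\frac1\theta$, $y=\frac{\xi}{\theta}$ turns $(\mathrm D)$ into $\frac{d\xi}{dt}=\theta^{-m}\Xi(\xi,\theta)$, $\frac{d\theta}{dt}=\theta^{-m}\Theta(\xi,\theta)$ with $m$ an integer and $\Xi,\Theta$ polynomials not both divisible by $\theta$; the first projectively reduced system is $\frac{d\xi}{d\tau}=\Xi$, $\frac{d\theta}{d\tau}=\Theta$. The substitution $x=\frac{\zeta}{\eta}$, $y=\frac1\eta$ turns $(\mathrm D)$ into $\frac{d\eta}{dt}=\eta^{-m}H(\eta,\zeta)$, $\frac{d\zeta}{dt}=\eta^{-m}Z(\eta,\zeta)$ with $H,Z$ polynomials not both divisible by $\eta$; the second projectively reduced system is $\frac{d\eta}{d\nu}=H$, $\frac{d\zeta}{d\nu}=Z$. The projective phase plane $\mathbb{RP}(x,y)$ is the plane $(x,y)$ completed by the line at infinity (''infinitely removed straight line''), covered by the charts $(x,y)$, $(\xi,\theta)=(\frac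 yx,\frac1x)$, $(\eta,\zeta)=(\frac1y,\frac xy)$; the line at infinity is $\theta=0$, respectively $\eta=0$. In these charts the trajectories are those of $(\mathrm D)$ and of the first and second projectively reduced systems. A line consists of trajectories if it is invariant: the vector field is tangent to it at each of its points (for the line at infinity, in both charts containing parts of it); e.g. $\theta=0$ consists of trajectories of the first reduced system iff $\Theta(\xi,0)\equiv0$, and $\eta=0$ of the second iff $H(0,\zeta)\equiv0$. *)

(* Defs.v *)
From HB Require Import structures.
From mathcomp Require Import all_boot all_order all_algebra.
From mathcomp Require Import reals topology normedtype derive.
(* The notations of mpoly clash with those of the analysis files. *)
From mathcomp Require Import -(notations) mpoly.

Set Implicit Arguments.
Unset Strict Implicit.
Unset Printing Implicit Defensive.

Import Order.TTheory GRing.Theory Num.Theory.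
Import numFieldNormedType.Exports.

Local Open Scope ring_scope.

Notation poly2 R := (mpoly 2 R).

Section Poly2.
Context {R : realType}.
Implicit Types p q d : poly2 R.

Definition pvar1 : poly2 R := mpolyX R (mnm1 ord0).
Definition pvar2 : poly2 R := mpolyX R (mnm1 ord_max).

Definition peval p (a b : R) : R := meval (tnth [tuple a; b]) p.

Definition psubst p (q1 q2 : poly2 R) : poly2 R :=
  comp_mpoly [tuple q1; q2] p.

Definition pdvd d p : Prop := exists q, p = d * q.

Definition prel_prime p q : Prop :=
  forall d, pdvd d p -> pdvd d q -> exists c : R, d = mpolyC 2 c.

Definition nonzero_on_plane p : Prop :=
  ~ (forall a b : R, peval p a b = 0).

End Poly2.

(* Only the components of index k <= n are meaningful.  The zero polynomial
   is homogeneous of every degree. *)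
Record systemD (R : realType) (n : nat) := SystemD {
  Xk : nat -> poly2 R;
  Yk : nat -> poly2 R;
  Xk_homog : forall k, (k <= n)%N -> Xk k \is ishomog1 k mdeg;
  Yk_homog : forall k, (k <= n)%N -> Yk k \is ishomog1 k mdeg;
  XYn_neq0 : ~ (Xk n = 0 /\ Yk n = 0);
  XY_rel_prime :
    prel_prime (\sum_(k < n.+1) Xk k) (\sum_(k < n.+1) Yk k)
}.

Section System.
Context {R : realType} {n : nat}.
Implicit Types D : systemD R n.

Definition Xpoly D : poly2 R := \sum_(k < n.+1) Xk D k.
Definition Ypoly D : poly2 R := \sum_(k < n.+1) Yk D k.

Definition Wk D (i : nat) : poly2 R := pvar1 * Yk D i - pvar2 * Xk D i.

Definition projectively_nonsingular D : Prop := nonzero_on_plane (Wk D n).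

(* The curve (u, v) satisfies du/dt = P(u, v), dv/dt = Q(u, v) at time t. *)
Definition solves_at (P Q : R -> R -> R) (u v : R -> R) (t : R) : Prop :=
  is_derive t 1 u (P (u t) (v t)) /\ is_derive t 1 v (Q (u t) (v t)).

(* [Xi] and [Theta] are polynomials in (xi, theta), in this order: the
   substitution x = 1/theta, y = xi/theta turns the system into
   dxi/dt = theta^(-m) Xi, dtheta/dt = theta^(-m) Theta. *)
Definition first_reduced D (Xi Theta : poly2 R) : Prop :=
  ~ (pdvd pvar2 Xi /\ pdvd pvar2 Theta) /\
  exists m : int, forall (xi theta : R -> R) (t : R), theta t != 0 ->
    solves_at (peval (Xpoly D)) (peval (Ypoly D))
      (fun s => 1 / theta s) (fun s => xi s / theta s) t
    <->
    solves_at (fun a b => b ^ (- m) * peval Xi a b)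
      (fun a b => b ^ (- m) * peval Theta a b) xi theta t.

(* [H] and [Z] are polynomials in (eta, zeta), in this order: the
   substitution x = zeta/eta, y = 1/eta turns the system into
   deta/dt = eta^(-m) H, dzeta/dt = eta^(-m) Z. *)
Definition second_reduced D (H Z : poly2 R) : Prop :=
  ~ (pdvd pvar1 H /\ pdvd pvar1 Z) /\
  exists m : int, forall (eta zeta : R -> R) (t : R), eta t != 0 ->
    solves_at (peval (Xpoly D)) (peval (Ypoly D))
      (fun s => zeta s / eta s) (fun s => 1 / eta s) t
    <->
    solves_at (fun a b => a ^ (- m) * peval H a b)
      (fun a b => a ^ (- m) * peval Z a b) eta zeta t.

(* The vector field (P, Q) is tangent to the line a u + b v + c = 0 of the
   (u, v)-plane at each point of this line. *)
Definition line_of_trajectories (P Q : poly2 R) (a b c : R) : Prop :=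
  forall u v : R, a * u + b * v + c = 0 ->
    a * peval P u v + b * peval Q u v = 0.

(* The line a X + b Y + c Z = 0 of the projective plane, in homogeneous
   coordinates, has the following equations in the charts (x, y) = (X/Z, Y/Z),
   (xi, theta) = (Y/X, Z/X) and (eta, zeta) = (Z/Y, X/Y):
   a x + b y + c = 0, b xi + c theta + a = 0 and c eta + a zeta + b = 0.
   The vector fields of the last two charts are those of the reduced systems
   (Xi, Theta) and (H, Z). *)
Definition projective_line_of_trajectories D (Xi Theta H Z : poly2 R)
    (a b c : R) : Prop :=
  [/\ line_of_trajectories (Xpoly D) (Ypoly D) a b c,
      line_of_trajectories Xi Theta b c a &
      line_of_trajectories H Z c a b].

(* The line at infinity is Z = 0. *)
Definition infinite_line_of_trajectories D (Xi Theta H Z : poly2 R) : Prop :=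
  projective_line_of_trajectories D Xi Theta H Z 0 0 1.

End System.

(* Main.v *)
Require Import Defs.
From mathcomp Require Import all_boot all_order all_algebra.
From mathcomp Require Import boolp functions reals topology normedtype derive.
From mathcomp Require Import realfun.
From mathcomp Require Import ring.
From mathcomp Require Import -(notations) mpoly.

Import GRing.Theory Num.Theory.
Import numFieldNormedType.Exports.

Local Open Scope ring_scope.

(** In the chart (xi, theta) the system is forced, off the line theta = 0, to
    read theta^k Xi = B and theta^k Theta = - theta A for a single integer k,
    where B is the sum of the theta^(n-i) W_i(1, xi) and A is the sum of the
    theta^(n-i) X_i(1, xi): the exponent is k = n - 1 - m
    ([reduced_field_sum]).  These are identities between polynomial functions
    on a dense set, hence between polynomials ([peval_eq_off_curve]).

    Everything then depends on whether theta divides B.  On theta = 0 the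
    polynomials B and A restrict to W_n(1, xi) and X_n(1, xi), and a
    homogeneous polynomial is determined by its values at the points (1, xi).
    So theta divides B exactly when W_n vanishes; and theta cannot divide both
    A and B, since X_n and W_n = x Y_n - y X_n would both vanish and with them
    Y_n.  The normalization of the reduced system, that theta does not divide
    both Xi and Theta, now leaves two cases ([reduced_form_equiv]).  If W_n is
    nonzero, then k = 0, so Xi = B and Theta = - theta A, and theta = 0 is
    invariant.  If W_n = 0, then k = 1, so Theta = - A is not divisible by
    theta and theta = 0 is not invariant.

    The chart (eta, zeta) is the same situation with x and y exchanged, so the
    formulas for both reduced systems and the invariance of the line at
    infinity in either chart are all equivalent to the nonvanishing of W_n
    ([first_reduced_equiv], [second_reduced_equiv]).  In the affine chart the
    line at infinity has no points, so that its invariance in the projective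
    plane is the conjunction of its invariance in the other two charts. *)

(** * Polynomials in two variables as functions on the plane *)

Section PolynomialsOnThePlane.
Context {R : realType}.
Implicit Types (p q b : poly2 R) (x y : R).

Lemma peval_monomialE (m : multinom 2) x y :
  peval (mpolyX R m) x y = x ^+ m ord0 * y ^+ m ord_max.
Proof.
rewrite /peval mevalX !big_ord_recl big_ord0 mulr1.
have -> : lift ord0 ord0 = ord_max :> 'I_2 by exact/val_inj.
by rewrite !(tnth_nth 0).
Qed.

Lemma pevalE p x y :
  peval p x y =
    \sum_(m <- msupp p) mcoeff m p * (x ^+ m ord0 * y ^+ m ord_max).
Proof.
rewrite /peval [in LHS](mpolyE p) raddf_sum /=; apply: eq_bigr => m _.
by rewrite mevalZ -peval_monomialE.
Qed.

Lemma peval_pvar1 x y : peval pvar1 x y = x.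
Proof. by rewrite /peval mevalXU (tnth_nth 0). Qed.

Lemma peval_pvar2 x y : peval pvar2 x y = y.
Proof. by rewrite /peval mevalXU (tnth_nth 0). Qed.

Lemma peval0 x y : peval 0 x y = 0 :> R.
Proof. exact: rmorph0. Qed.

Lemma peval1 x y : peval 1 x y = 1 :> R.
Proof. exact: rmorph1. Qed.

Lemma pevalN p x y : peval (- p) x y = - peval p x y.
Proof. exact: rmorphN. Qed.

Lemma pevalB p q x y : peval (p - q) x y = peval p x y - peval q x y.
Proof. exact: rmorphB. Qed.

Lemma pevalM p q x y : peval (p * q) x y = peval p x y * peval q x y.
Proof. exact: rmorphM. Qed.

Lemma pevalX p k x y : peval (p ^+ k) x y = peval p x y ^+ k.
Proof. exact: rmorphXn. Qed.

Lemma peval_sum n (F : 'I_n -> poly2 R) x y :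
  peval (\sum_(i < n) F i) x y = \sum_(i < n) peval (F i) x y.
Proof. exact: rmorph_sum. Qed.

Lemma peval_psubst p q1 q2 x y :
  peval (psubst p q1 q2) x y = peval p (peval q1 x y) (peval q2 x y).
Proof.
rewrite /peval /psubst comp_mpoly_meval; apply: meval_eq => i.
by rewrite !(tnth_nth 0); case: i => [[|[|]]] //=.
Qed.

Lemma poly_eq0_on_line (p : {poly R}) : (forall x, p.[x] = 0) -> p = 0.
Proof.
move=> p0; apply/eqP/negPn/negP => pN0.
have := @max_poly_roots _ p [seq i%:R | i <- iota 0 (size p)] pN0.
rewrite size_map size_iota ltnn => /(_ _ _)/notF; apply.
  by apply/allP => x _; rewrite /root p0.
by rewrite map_inj_uniq ?iota_uniq //; exact/mulrIn/oner_neq0.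
Qed.

(** Kronecker substitution: on the curve y = x^N, with N larger than every
    exponent of x, distinct monomials of p become distinct powers of x, so the
    coefficients of p are those of a univariate polynomial that vanishes
    everywhere. *)
Lemma peval_eq0 p : (forall x y, peval p x y = 0) -> p = 0.
Proof.
move=> p0; set N := msize p.
pose code (m : multinom 2) := (m ord0 + N * m ord_max)%N.
have small m : m \in msupp p -> (m ord0 < N)%N.
  move=> /msize_mdeg_lt; apply: leq_ltn_trans.
  by rewrite mdegE big_ord_recl leq_addr.
have code_inj m m' : m \in msupp p -> m' \in msupp p ->
    code m = code m' -> m = m'.
  move=> /small mN /small m'N e.
  have e0 : m ord0 = m' ord0.
    have := congr1 (modn^~ N) e.
    rewrite /code /= ![(_ + N * _)%N]addnC ![(N * _)%N]mulnC.
    by rewrite !modnMDl !modn_small.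
  have e1 : m ord_max = m' ord_max.
    move/eqP: e; rewrite /code e0 eqn_add2l eqn_pmul2l; first by move/eqP.
    exact: leq_ltn_trans mN.
  apply/mnmP => -[[|[|]]] // i.
    by rewrite (_ : Ordinal i = ord0) //; exact/val_inj.
  by rewrite (_ : Ordinal i = ord_max) //; exact/val_inj.
(* The univariate polynomial p(x, x^N). *)
have q0 : \sum_(m <- msupp p) mcoeff m p *: 'X^(code m) = 0 :> {poly R}.
  apply: poly_eq0_on_line => x; rewrite -(p0 x (x ^+ N)) pevalE horner_sum.
  by apply: eq_bigr => m _; rewrite hornerZ hornerXn exprD exprM.
apply/mpolyP => m; rewrite mcoeff0.
have [mp|] := boolP (m \in msupp p); last by rewrite -mcoeff_eq0 => /eqP.
have := congr1 (fun q : {poly R} => q`_(code m)) q0.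
rewrite coef0 coef_sum (bigD1_seq m) ?msupp_uniq //= coefZ coefXn eqxx mulr1.
rewrite big1_seq ?addr0 // => m' /andP[m'm m'p].
rewrite coefZ coefXn; case: eqP => [e|_]; last by rewrite mulr0.
by rewrite (code_inj _ _ mp m'p e) eqxx in m'm.
Qed.

(** Multiplying the difference p - q by b turns an identity off the curve b = 0
    into an identity on the whole plane. *)
Lemma peval_eq_off_curve b p q : b != 0 ->
  (forall x y, peval b x y != 0 -> peval p x y = peval q x y) -> p = q.
Proof.
move=> b0 pq; apply/eqP; rewrite -subr_eq0; apply/eqP.
apply: (mulfI b0); rewrite mulr0; apply: peval_eq0 => x y.
rewrite pevalM pevalB; have [->|bxy] := eqVneq (peval b x y) 0.
  by rewrite mul0r.
by rewrite pq // subrr mulr0.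
Qed.

Lemma pvar1_neq0 : pvar1 != 0 :> poly2 R.
Proof.
apply/eqP => e; have := peval_pvar1 1 0.
by rewrite e peval0 => /esym/eqP; rewrite oner_eq0.
Qed.

Lemma pvar2_neq0 : pvar2 != 0 :> poly2 R.
Proof.
apply/eqP => e; have := peval_pvar2 0 1.
by rewrite e peval0 => /esym/eqP; rewrite oner_eq0.
Qed.

(** The remainder r collects the monomials in which the variable i does not
    occur. *)
Lemma division_by_variable (i : 'I_2) p :
  exists q r, p = mpolyX R (mnm1 i) * q + r /\
    forall v w : 'I_2 -> R, (forall j, j != i -> v j = w j) ->
      meval v r = meval w r.
Proof.
elim/mpolyind: p => [|c m p _ _ [q [r [-> rE]]]].
  by exists 0, 0; rewrite mulr0 addr0; split=> // v w _; rewrite !meval0.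
have [mi|mi] := eqVneq (m i) 0%N; last first.
  exists (q + c *: mpolyX R (mnm_sub m (mnm1 i))), r; split=> //.
  rewrite mulrDr -scalerAr -mpolyXD addmC submK ?lep1mP // addrA.
  by rewrite [_ *: _ + _]addrC.
exists q, (c *: mpolyX R m + r); split; first by rewrite addrCA.
move=> v w vw; rewrite !mevalD (rE _ _ vw) !mevalZ !mevalX; congr (_ * _ + _).
apply: eq_bigr => j _; have [->|ji] := eqVneq j i; first by rewrite mi.
by rewrite vw.
Qed.

(** The remainder of the division by a variable does not depend on that
    variable, so it vanishes on the plane as soon as it vanishes on the axis
    where p does. *)
Lemma pdvd_pvar1P p : pdvd pvar1 p <-> forall y, peval p 0 y = 0.
Proof.
split=> [[q ->] y|p0]; first by rewrite pevalM peval_pvar1 mul0r.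
have [q [r [pE rE]]] := division_by_variable ord0 p; exists q.
suff r0 : r = 0 by rewrite pE r0 addr0.
apply: peval_eq0 => x y; transitivity (peval r 0 y).
  by apply: rE => -[[|[|]]] // j; rewrite !(tnth_nth 0).
have := p0 y; rewrite pE /peval mevalD mevalM -!/(peval _ _ _).
by rewrite -/pvar1 peval_pvar1 mul0r add0r.
Qed.

Lemma pdvd_pvar2P p : pdvd pvar2 p <-> forall x, peval p x 0 = 0.
Proof.
split=> [[q ->] x|p0]; first by rewrite pevalM peval_pvar2 mul0r.
have [q [r [pE rE]]] := division_by_variable ord_max p; exists q.
suff r0 : r = 0 by rewrite pE r0 addr0.
apply: peval_eq0 => x y; transitivity (peval r x 0).
  by apply: rE => -[[|[|]]] // j; rewrite !(tnth_nth 0).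
have := p0 x; rewrite pE /peval mevalD mevalM -!/(peval _ _ _).
by rewrite -/pvar2 peval_pvar2 mul0r add0r.
Qed.

Lemma line_of_trajectories_pvar1 p q :
  line_of_trajectories p q 1 0 0 <-> pdvd pvar1 p.
Proof.
rewrite pdvd_pvar1P; split=> [line y|p0 u v].
  by have := line 0 y; rewrite !mul0r mulr0 mul1r !addr0; apply.
by rewrite !mul0r !addr0 !mul1r => ->.
Qed.

Lemma line_of_trajectories_pvar2 p q :
  line_of_trajectories p q 0 1 0 <-> pdvd pvar2 q.
Proof.
rewrite pdvd_pvar2P; split=> [line x|q0 u v].
  by have := line x 0; rewrite !mul0r mulr0 mul1r !add0r; apply.
by rewrite !mul0r !mul1r !addr0 !add0r => ->.
Qed.

End PolynomialsOnThePlane.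

(** * Homogeneous functions *)

Section Homogeneity.
Context {R : realType}.
Implicit Types (p : poly2 R) (f : R -> R -> R).

(** Stated for functions, so that it applies to W_i and to polynomials with
    exchanged arguments alike. *)
Definition homogeneous k f :=
  forall c x y, f (c * x) (c * y) = c ^+ k * f x y.

Lemma peval_homogeneous k p :
  p \is ishomog1 k mdeg -> homogeneous k (peval p).
Proof.
move=> /allP hp c x y; rewrite !pevalE big_distrr; apply: eq_big_seq => m /hp.
rewrite /= mdegE !big_ord_recl big_ord0 addn0.
have -> : lift ord0 ord0 = ord_max :> 'I_2 by exact/val_inj.
by move=> /eqP <-; rewrite !exprMn exprD; ring.
Qed.

Lemma homogeneous_swap k f :
  homogeneous k f -> homogeneous k (fun x y => f y x).
Proof. by move=> hf c x y; apply: hf. Qed.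

(** A point (x, y) with x <> 0 is the multiple by x of (1, y / x). *)
Lemma homogeneous_eq0_1l k p : homogeneous k (peval p) ->
  (forall a, peval p 1 a = 0) -> p = 0.
Proof.
move=> hp p0; apply: (peval_eq_off_curve _ _ _ pvar1_neq0) => x y.
rewrite peval_pvar1 peval0 => x0.
by rewrite -[x in LHS]mulr1 -(divfK x0 y) [y / x * x]mulrC hp p0 mulr0.
Qed.

Lemma homogeneous_eq0_1r k p : homogeneous k (peval p) ->
  (forall a, peval p a 1 = 0) -> p = 0.
Proof.
move=> hp p0; apply: (peval_eq_off_curve _ _ _ pvar2_neq0) => x y.
rewrite peval_pvar2 peval0 => y0.
by rewrite -[y in LHS]mulr1 -(divfK y0 x) [x / y * y]mulrC hp p0 mulr0.
Qed.

Lemma sum_homogeneous n (f : nat -> R -> R -> R) (a b : R) : b != 0 ->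
  (forall i, (i <= n)%N -> homogeneous i (f i)) ->
  \sum_(i < n.+1) b ^+ (n - i) * f i 1 a =
    b ^+ n * \sum_(i < n.+1) f i (1 / b) (a / b).
Proof.
move=> b0 hf; rewrite big_distrr; apply: eq_bigr => i _ /=.
have in_ : (i <= n)%N by rewrite -ltnS.
have -> : f i (1 / b) (a / b) = b^-1 ^+ i * f i 1 a.
  by rewrite -hf // mulr1 mul1r mulrC.
by rewrite mulrA exprB ?unitfE // exprVn.
Qed.

End Homogeneity.

(** * The change of chart *)

Section ProjectiveCharts.
Context {R : realType}.

Lemma is_derive_uniq (f : R -> R) (t df dg : R) :
  is_derive t 1 f df -> is_derive t 1 f dg -> df = dg.
Proof. by move=> [_ <-] [_ <-]. Qed.

Lemma is_derive_affine (t c d : R) :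
  is_derive t 1 (fun s => c + (s - t) * d) d.
Proof.
have dB := is_deriveB (is_derive_id t 1) (is_derive_cst t t 1).
have dM := is_deriveM dB (is_derive_cst d t 1).
apply: (is_derive_eq (is_deriveD (is_derive_cst c t 1) dM)).
by rewrite scaler0 !add0r subr0 /GRing.scale /= mulr1.
Qed.

Lemma is_derive_inv (f : R -> R) (t df : R) : f t != 0 ->
  is_derive t 1 f df -> is_derive t 1 (fun s => 1 / f s) (- df / f t ^+ 2).
Proof.
move=> ft0 hf; have -> : (fun s => 1 / f s) = (fun s => (f s)^-1).
  by apply/funext => s; rewrite mul1r.
by apply: (is_derive_eq (is_deriveV ft0 hf)); rewrite /GRing.scale /=; field.
Qed.

Lemma is_derive_div (f g : R -> R) (t df dg : R) : f t != 0 ->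
  is_derive t 1 f df -> is_derive t 1 g dg ->
  is_derive t 1 (fun s => g s / f s) (dg / f t - g t * df / f t ^+ 2).
Proof.
move=> ft0 hf hg; have h := is_deriveM hg (is_derive_inv _ _ _ ft0 hf).
have -> : (fun s => g s / f s) = g * (fun s => 1 / f s).
  by apply/funext => s; rewrite -[RHS]/(g s * (1 / f s)) mul1r.
by apply: (is_derive_eq h); rewrite /GRing.scale /=; field.
Qed.

(** Every point (a, b) with b <> 0 is traversed at time 0 with velocity
    (P(a, b), Q(a, b)) by a curve of affine motion.  Being a solution at that
    time, it remains one after the change of chart, and the chain rule
    determines its velocity there. *)
Lemma chart_change_field (F G P Q : R -> R -> R) :
  (forall (u v : R -> R) (t : R), v t != 0 ->
    solves_at F G (fun s => 1 / v s) (fun s => u s / v s) t <->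
    solves_at P Q u v t) ->
  forall a b, b != 0 ->
    P a b = b * (G (1 / b) (a / b) - a * F (1 / b) (a / b)) /\
    Q a b = - (b ^+ 2 * F (1 / b) (a / b)).
Proof.
move=> change a b b0.
pose u s := a + (s - 0) * P a b; pose v s := b + (s - 0) * Q a b.
have u0 : u 0 = a by rewrite /u subrr mul0r addr0.
have v0 : v 0 = b by rewrite /v subrr mul0r addr0.
have vn0 : v 0 != 0 by rewrite v0.
have du : is_derive (0 : R) 1 u (P a b) by exact: is_derive_affine.
have dv : is_derive (0 : R) 1 v (Q a b) by exact: is_derive_affine.
have [|dF dG] := (change u v 0 vn0).2; first by split; rewrite u0 v0.
have := is_derive_uniq _ _ _ _ dG (is_derive_div _ _ _ _ _ vn0 dv du).
have := is_derive_uniq _ _ _ _ dF (is_derive_inv _ _ _ vn0 dv).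
by rewrite u0 v0 => -> ->; split; field.
Qed.

(** Multiplying the equations of the change of chart by b^(n-1) clears the
    denominators of the homogeneous components, of degree at most n, and leaves
    the power n - 1 - m in front of the reduced field. *)
Lemma reduced_field_sum n (f g : nat -> R -> R -> R) (P Q : R -> R -> R)
    (m : int) :
  (forall i, (i <= n)%N -> homogeneous i (f i)) ->
  (forall i, (i <= n)%N -> homogeneous i (g i)) ->
  (forall (u v : R -> R) (t : R), v t != 0 ->
    solves_at (fun x y => \sum_(i < n.+1) f i x y)
      (fun x y => \sum_(i < n.+1) g i x y)
      (fun s => 1 / v s) (fun s => u s / v s) t <->
    solves_at (fun a b => b ^ (- m) * P a b) (fun a b => b ^ (- m) * Q a b)
      u v t) ->
  forall a b, b != 0 ->
    b ^ (n%:Z - 1 - m) * P a b =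
      \sum_(i < n.+1) b ^+ (n - i) * (g i 1 a - a * f i 1 a) /\
    b ^ (n%:Z - 1 - m) * Q a b =
      - (b * \sum_(i < n.+1) b ^+ (n - i) * f i 1 a).
Proof.
move=> hf hg /chart_change_field change a b b0; have [PE QE] := change a b b0.
have -> : b ^ (n%:Z - 1 - m) = b ^+ n / b * b ^ (- m).
  by rewrite !expfzDr // -exprnP.
have -> : \sum_(i < n.+1) b ^+ (n - i) * (g i 1 a - a * f i 1 a) =
    \sum_(i < n.+1) b ^+ (n - i) * g i 1 a -
    a * \sum_(i < n.+1) b ^+ (n - i) * f i 1 a.
  rewrite big_distrr -sumrB; apply: eq_bigr => i _ /=.
  by rewrite mulrBr mulrCA.
by rewrite -!mulrA PE QE !sum_homogeneous //; split; field.
Qed.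

End ProjectiveCharts.

(** * The power of the line at infinity in the reduced system *)

Section ReducedForm.
Context {R : realType}.
Implicit Types b P Q A B : poly2 R.

(** A negative k would make b divide both P and Q.  If k is positive, then b
    divides B, hence not A; as b^(k-1) Q = - A, neither does b divide Q, and
    all three conditions fail.  If k = 0, then P = B and Q = - b A, so that b
    divides Q, hence not P, and all three hold. *)
Lemma reduced_form_equiv b P Q A B (k : int) : b != 0 ->
  ~ (pdvd b P /\ pdvd b Q) -> ~ (pdvd b A /\ pdvd b B) ->
  (forall x y, peval b x y != 0 ->
    peval b x y ^ k * peval P x y = peval B x y /\
    peval b x y ^ k * peval Q x y = - (peval b x y * peval A x y)) ->
  [<-> ~ pdvd b B; P = B /\ Q = - b * A; pdvd b Q].
Proof.
move=> b0 nPQ nAB E.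
have b_dvd p : pdvd b (b * p) by exists p.
have b_dvdN p : pdvd b (- b * p) by exists (- p); rewrite mulNr mulrN.
(* The second case is k = - (j + 1). *)
have {E} [[j [PE QE]]|[j [PE QE]]] :
    (exists j, b ^+ j * P = B /\ b ^+ j * Q = - b * A) \/
    (exists j, P = b ^+ j.+1 * B /\ Q = b ^+ j.+1 * (- b * A)).
- case: k E => j E; [left|right]; exists j; split;
    apply: (peval_eq_off_curve _ _ _ b0) => x y bxy;
    have [EP EQ] := E x y bxy; rewrite !pevalM ?pevalN ?pevalX.
  + exact: EP.
  + by rewrite mulNr; exact: EQ.
  + by rewrite -EP NegzE mulrA mulfV ?mul1r // expf_neq0.
  + by rewrite mulNr -EQ NegzE mulrA mulfV ?mul1r // expf_neq0.
- case: j PE QE => [|j]; rewrite ?expr0 ?mul1r ?exprS => PE QE.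
    tfae => [_|[_ ->]|dQ dB] //; apply: nPQ; split=> //.
    by rewrite PE.
  have dB : pdvd b B by rewrite -PE -mulrA.
  have AE : b ^+ j * Q = - A.
    by apply: (mulfI b0); rewrite mulrA QE mulNr mulrN.
  have ndQ : ~ pdvd b Q.
    move=> [q qE]; apply: nAB; split=> //; exists (- (b ^+ j * q)).
    by rewrite -[A]opprK -AE qE mulrN mulrCA.
  tfae => // [[_ QE']]; by rewrite QE'.
- by case: nPQ; rewrite PE QE exprS -!mulrA.
Qed.

End ReducedForm.

(** * The two reduced systems *)

Section ReducedSystems.
Context {R : realType} {n : nat}.
Implicit Types D : systemD R n.

Lemma Wk_homogeneous D i : (i <= n)%N -> homogeneous i.+1 (peval (Wk D i)).
Proof.
move=> in_ c x y.
have hX := peval_homogeneous _ _ (Xk_homog D in_).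
have hY := peval_homogeneous _ _ (Yk_homog D in_).
rewrite !pevalB !pevalM !peval_pvar1 !peval_pvar2 hX hY exprS; ring.
Qed.

Lemma nonzero_on_planeP (p : poly2 R) : nonzero_on_plane p <-> p <> 0.
Proof.
split=> [p0 pE|p0 /peval_eq0 //]; apply: p0 => a b.
by rewrite pE peval0.
Qed.

Lemma first_reduced_equiv D Xi Theta : first_reduced D Xi Theta ->
  [<-> nonzero_on_plane (Wk D n);
    Xi = \sum_(i < n.+1) pvar2 ^+ (n - i) * psubst (Wk D i) 1 pvar1 /\
    Theta =
      - pvar2 * \sum_(i < n.+1) pvar2 ^+ (n - i) * psubst (Xk D i) 1 pvar1;
    line_of_trajectories Xi Theta 0 1 0].
Proof.
case=> nXiTheta [m change].
have hX i : (i <= n)%N -> homogeneous i (peval (Xk D i)).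
  by move=> in_; exact/peval_homogeneous/Xk_homog.
have hY i : (i <= n)%N -> homogeneous i (peval (Yk D i)).
  by move=> in_; exact/peval_homogeneous/Yk_homog.
set B := \sum_(i < n.+1) _ * psubst (Wk D i) _ _.
set A := \sum_(i < n.+1) _ * psubst (Xk D i) _ _.
have sumE (F : nat -> poly2 R) x y :
    peval (\sum_(i < n.+1) pvar2 ^+ (n - i) * psubst (F i) 1 pvar1) x y =
    \sum_(i < n.+1) y ^+ (n - i) * peval (F i) 1 x.
  rewrite peval_sum; apply: eq_bigr => i _.
  by rewrite pevalM pevalX peval_psubst peval_pvar1 peval_pvar2 peval1.
have sum0 (F : nat -> poly2 R) x :
    peval (\sum_(i < n.+1) pvar2 ^+ (n - i) * psubst (F i) 1 pvar1) x 0 =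
    peval (F n) 1 x.
  rewrite sumE big_ord_recr /= subnn mul1r big1 ?add0r // => i _.
  by rewrite expr0n subn_eq0 leqNgt ltn_ord mul0r.
have dvdB : pdvd pvar2 B <-> Wk D n = 0.
  rewrite pdvd_pvar2P; split=> [B0|W0 x]; last by rewrite sum0 W0 peval0.
  apply: (homogeneous_eq0_1l _ _ (Wk_homogeneous D n (leqnn n))) => a.
  by rewrite -sum0.
have nAB : ~ (pdvd pvar2 A /\ pdvd pvar2 B).
  case=> /pdvd_pvar2P A0 /dvdB W0; apply: (@XYn_neq0 _ _ D).
  have X0 : Xk D n = 0.
    by apply: (homogeneous_eq0_1l _ _ (hX n _)) => // a; rewrite -sum0.
  split=> //; apply: (homogeneous_eq0_1l _ _ (hY n _)) => // a.
  have := congr1 (fun p => peval p 1 a) W0.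
  by rewrite pevalB X0 mulr0 !peval0 subr0 pevalM peval_pvar1 mul1r.
have E x y : peval pvar2 x y != 0 ->
    peval pvar2 x y ^ (n%:Z - 1 - m) * peval Xi x y = peval B x y /\
    peval pvar2 x y ^ (n%:Z - 1 - m) * peval Theta x y =
      - (peval pvar2 x y * peval A x y).
  rewrite peval_pvar2 => y0; rewrite !sumE.
  have [|PE QE] := reduced_field_sum n (fun i => peval (Xk D i))
    (fun i => peval (Yk D i)) (peval Xi) (peval Theta) m hX hY _ x y y0.
    move=> u v t vt0; rewrite -change // /solves_at.
    by rewrite /Xpoly /Ypoly !peval_sum.
  split=> //; rewrite PE; apply: eq_bigr => i _.
  by rewrite pevalB !pevalM peval_pvar1 peval_pvar2 mul1r.
have T := reduced_form_equiv _ _ _ _ _ _ pvar2_neq0 nXiTheta nAB E.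
tfae.
- by move=> /nonzero_on_planeP W0; apply/(T 0 1)%N => /dvdB.
- by move=> /(T 1 2)%N/line_of_trajectories_pvar2.
- move=> /line_of_trajectories_pvar2 dTheta.
  by apply/nonzero_on_planeP => /dvdB; apply/(T 0 2)%N.
Qed.

(** Exchanging the roles of x and y, and of the two coordinates of the chart,
    reduces the second chart to the computation of the first; the exchange
    changes the sign of W_i, whence the sign in the formula for Z. *)
Lemma second_reduced_equiv D H Z : second_reduced D H Z ->
  [<-> nonzero_on_plane (Wk D n);
    H = - pvar1 * \sum_(i < n.+1) pvar1 ^+ (n - i) * psubst (Yk D i) pvar2 1 /\
    Z = - \sum_(i < n.+1) pvar1 ^+ (n - i) * psubst (Wk D i) pvar2 1;
    line_of_trajectories H Z 1 0 0].
Proof.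
case=> nHZ [m change].
have hX i : (i <= n)%N -> homogeneous i (fun x y => peval (Xk D i) y x).
  by move=> in_; exact/homogeneous_swap/peval_homogeneous/Xk_homog.
have hY i : (i <= n)%N -> homogeneous i (fun x y => peval (Yk D i) y x).
  by move=> in_; exact/homogeneous_swap/peval_homogeneous/Yk_homog.
set B := \sum_(i < n.+1) _ * psubst (Wk D i) _ _.
set A := \sum_(i < n.+1) _ * psubst (Yk D i) _ _.
have sumE (F : nat -> poly2 R) x y :
    peval (\sum_(i < n.+1) pvar1 ^+ (n - i) * psubst (F i) pvar2 1) x y =
    \sum_(i < n.+1) x ^+ (n - i) * peval (F i) y 1.
  rewrite peval_sum; apply: eq_bigr => i _.
  by rewrite pevalM pevalX peval_psubst peval_pvar1 peval_pvar2 peval1.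
have sum0 (F : nat -> poly2 R) y :
    peval (\sum_(i < n.+1) pvar1 ^+ (n - i) * psubst (F i) pvar2 1) 0 y =
    peval (F n) y 1.
  rewrite sumE big_ord_recr /= subnn mul1r big1 ?add0r // => i _.
  by rewrite expr0n subn_eq0 leqNgt ltn_ord mul0r.
have dvdB : pdvd pvar1 (- B) <-> Wk D n = 0.
  rewrite pdvd_pvar1P; split=> [B0|W0 y]; last first.
    by rewrite pevalN sum0 W0 peval0 oppr0.
  apply: (homogeneous_eq0_1r _ _ (Wk_homogeneous D n (leqnn n))) => a.
  by apply: oppr_inj; rewrite -sum0 -pevalN B0 oppr0.
have nAB : ~ (pdvd pvar1 A /\ pdvd pvar1 (- B)).
  case=> /pdvd_pvar1P A0 /dvdB W0; apply: (@XYn_neq0 _ _ D).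
  have Y0 : Yk D n = 0.
    apply: (homogeneous_eq0_1r n) => [|a]; last by rewrite -sum0.
    exact/peval_homogeneous/Yk_homog.
  split=> //; apply: (homogeneous_eq0_1r n) => [|a].
    exact/peval_homogeneous/Xk_homog.
  have /eqP := congr1 (fun p => peval p a 1) W0.
  rewrite pevalB Y0 mulr0 !peval0 sub0r pevalM peval_pvar2 mul1r oppr_eq0.
  by move/eqP.
have E x y : peval pvar1 x y != 0 ->
    peval pvar1 x y ^ (n%:Z - 1 - m) * peval Z x y = peval (- B) x y /\
    peval pvar1 x y ^ (n%:Z - 1 - m) * peval H x y =
      - (peval pvar1 x y * peval A x y).
  rewrite peval_pvar1 => x0; rewrite pevalN !sumE.
  have [|PE QE] := reduced_field_sum n (fun i a b => peval (Yk D i) b a)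
    (fun i a b => peval (Xk D i) b a) (fun a b => peval Z b a)
    (fun a b => peval H b a) m hY hX _ y x x0.
    move=> u v t vt0; have := change v u t vt0.
    rewrite /solves_at /Xpoly /Ypoly !peval_sum => -[c1 c2].
    by split=> -[d1 d2]; apply/and_comm; [apply: c1|apply: c2].
  split=> //; rewrite PE -sumrN; apply: eq_bigr => i _.
  by rewrite pevalB !pevalM peval_pvar1 peval_pvar2 mul1r -[RHS]mulrN opprB.
have nZH : ~ (pdvd pvar1 Z /\ pdvd pvar1 H) by move=> [dZ dH]; apply: nHZ.
have T := reduced_form_equiv _ _ _ _ _ _ pvar1_neq0 nZH nAB E.
tfae.
- by move=> /nonzero_on_planeP W0; apply/and_comm/(T 0 1)%N => /dvdB.
- by move=> /and_comm/(T 1 2)%N/line_of_trajectories_pvar1.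
- move=> /line_of_trajectories_pvar1 dH.
  by apply/nonzero_on_planeP => /dvdB; apply/(T 0 2)%N.
Qed.

End ReducedSystems.

Theorem mainTheorem12 (R : realType) (n : nat) (D : systemD R n)
    (Xi Theta H Z : poly2 R)
    (hfirst : first_reduced D Xi Theta) (hsecond : second_reduced D H Z) :
  [<->
    infinite_line_of_trajectories D Xi Theta H Z;
    nonzero_on_plane (Wk D n);
    projectively_nonsingular D;
    let xi := pvar1 in let theta := pvar2 in
      Xi = \sum_(i < n.+1) theta ^+ (n - i) * psubst (Wk D i) 1 xi /\
      Theta =
        - theta * \sum_(i < n.+1) theta ^+ (n - i) * psubst (Xk D i) 1 xi;
    line_of_trajectories Xi Theta 0 1 0;
    let eta := pvar1 in let zeta := pvar2 in
      H = - eta * \sum_(i < n.+1) eta ^+ (n - i) * psubst (Yk D i) zeta 1 /\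
      Z = - \sum_(i < n.+1) eta ^+ (n - i) * psubst (Wk D i) zeta 1;
    line_of_trajectories H Z 1 0 0].
Proof.
have T1 := first_reduced_equiv _ _ _ hfirst.
have T2 := second_reduced_equiv _ _ _ hsecond.
tfae.
- by case=> _ /(T1 0 2)%N.
- by [].
- exact: (T1 0 1)%N.1.
- exact: (T1 1 2)%N.1.
- by move=> /(T1 0 2)%N/(T2 0 1)%N.
- exact: (T2 1 2)%N.1.
- move=> line; split=> //; last exact/(T1 0 2)%N/(T2 0 2)%N.
  (* In the affine chart the line at infinity has the equation 1 = 0. *)
  by move=> u v /eqP; rewrite !mul0r !add0r oner_eq0.
Qed.
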